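(* Let $h>0$ and $\lambda_1\in\mathbb{C}\setminus\{0\}$. Let $(U_n(t),R_n(t),Q_n(t))_{n\in\mathbb{Z}}$ be a solution of the semi-discrete massive Thirring model (MTM) system (defined in the context). Let $\Phi_n(t)=(f_n(t),g_n(t))^T$, $n\in\mathbb{Z}$, be a nonzero solution of both equations of the Lax pair at $\lambda=\lambda_1$ with these potentials. Define $$U^{[1]}_n = -\frac{2\mathrm{i} (\bar{\lambda}_1 |f_n|^2 + \lambda_1 |g_n|^2) U_n - h |\lambda_1|^2 (\lambda_1 |f_n|^2 + \bar{\lambda}_1 |g_n|^2) U_n + 2\mathrm{i} (\lambda_1^2 - \bar{\lambda}_1^2) f_n \bar{g}_n}{2\mathrm{i} (\lambda_1 |f_n|^2 + \bar{\lambda}_1 |g_n|^2) - h |\lambda_1|^2 (\bar{\lambda}_1 |f_n|^2 + \lambda_1 |g_n|^2) + h (\lambda_1^2 - \bar{\lambda}_1^2) \bar{f}_n g_n U_n},$$ $$R^{[1]}_{n} = -\frac{( \bar{\lambda}_1 |f_{n}|^2 + \lambda_1 |g_{n}|^2) R_n + (\lambda_1^2-\bar{\lambda}_1^2) f_{n} \bar{g}_{n}}{\lambda_1 |f_{n}|^2 + \bar{\lambda}_1 |g_{n}|^2},$$ $$Q^{[1]}_{n} = -\frac{|\lambda_1|^2 ( \lambda_1 |f_{n}|^2+\bar{\lambda}_1 |g_{n}|^2) Q_n + (\lambda_1^2-\bar{\lambda}_1^2) f_{n} \bar{g}_{n}}{|\lambda_1|^2(\bar{\lambda}_1 |f_{n}|^2+\lambda_1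 |g_{n}|^2)},$$ at all $(n,t)$ where the denominators are nonzero. Then $(U^{[1]}_n,R^{[1]}_n,Q^{[1]}_n)$ is again a solution of the semi-discrete MTM system.
   Context: Fix a lattice spacing $h>0$. The semi-discrete MTM system for complex-valued differentiable functions $U_n(t),R_n(t),Q_n(t)$, $n\in\mathbb{Z}$, $t\in\mathbb{R}$, is $$4\mathrm{i}\frac{dU_n}{dt}+Q_{n+1}+Q_n+\frac{2\mathrm{i}}{h}(R_{n+1}-R_n)+U_n^2(\bar R_n+\bar R_{n+1})-U_n(|Q_{n+1}|^2+|Q_n|^2+|R_{n+1}|^2+|R_n|^2)-\frac{\mathrm{i}h}{2}U_n^2(\bar Q_{n+1}-\bar Q_n)=0,$$ $$-\frac{2\mathrm{i}}{h}(Q_{n+1}-Q_n)+2U_n-|U_n|^2(Q_{n+1}+Q_n)=0,\qquad R_{n+1}+R_n-2U_n+\frac{\mathrm{i}h}{2}|U_n|^2(R_{n+1}-R_n)=0.$$ The Lax pair with spectral parameter $\lambda\in\mathbb{C}\setminus\{0\}$ consists of the two linear equations for $\Phi_n(t)\in\mathbb{C}^2$: $$\Phi_{n+1}=N_n(\lambda)\Phi_n,\quad N_n(\lambda)=\begin{pmatrix}\lambda+\frac{2\mathrm{i}}{h\lambda}S_n & \frac{2U_n}{1-\frac{\mathrm{i}}{2}h|U_n|^2}\\ \frac{2\bar U_n}{1-\frac{\mathrm{i}}{2}h|U_n|^2} & \frac{2\mathrm{i}}{h\lambda}-\lambda S_n\end{pmatrix},\quad S_n=\frac{1+\frac{\mathrm{i}}{2}h|U_n|^2}{1-\frac{\mathrm{i}}{2}h|U_n|^2},$$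 $$\frac{d\Phi_n}{dt}=P_n(\lambda)\Phi_n,\quad P_n(\lambda)=\frac{\mathrm{i}}{2}\begin{pmatrix}\lambda^2-|R_n|^2 & \lambda R_n-Q_n\lambda^{-1}\\ \lambda\bar R_n-\bar Q_n\lambda^{-1} & |Q_n|^2-\lambda^{-2}\end{pmatrix}.$$ The semi-discrete MTM system is the compatibility condition $\frac{d}{dt}N_n=P_{n+1}N_n-N_nP_n$ of this Lax pair. *)

(* Defs.v *)
(* complex numbers are modelled as pairs of reals, since the
   problem involves time derivatives of complex-valued functions of a real
   variable (Stdlib Reals derivatives, applied componentwise). *)
From Stdlib Require Import Reals ZArith.
Open Scope R_scope.

Definition Cpx : Type := (R * R)%type.
Definition RtoC (r : R) : Cpx := (r, 0).
Definition C0 : Cpx := (0, 0).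
Definition C1 : Cpx := (1, 0).
Definition Ci : Cpx := (0, 1).
Definition Cplus (z w : Cpx) : Cpx := (fst z + fst w, snd z + snd w).
Definition Copp (z : Cpx) : Cpx := (- fst z, - snd z).
Definition Cminus (z w : Cpx) : Cpx := Cplus z (Copp w).
Definition Cmult (z w : Cpx) : Cpx :=
  (fst z * fst w - snd z * snd w, fst z * snd w + snd z * fst w).
Definition Cnorm2 (z : Cpx) : R := fst z * fst z + snd z * snd z.
Definition Cconj (z : Cpx) : Cpx := (fst z, - snd z).
Definition Cinv (z : Cpx) : Cpx := (fst z / Cnorm2 z, - snd z / Cnorm2 z).
Definition Cdiv (z w : Cpx) : Cpx := Cmult z (Cinv w).

Infix "+c" := Cplus (at level 50, left associativity).
Infix "-c" := Cminus (at level 50, left associativity).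
Infix "*c" := Cmult (at level 40, left associativity).
Infix "/c" := Cdiv (at level 40, left associativity).
Notation "-c z" := (Copp z) (at level 35, right associativity).
Notation "'|' z '|^2'" := (RtoC (Cnorm2 z)) (at level 0, z at level 99).

Definition C_deriv_at (F : R -> Cpx) (t : R) (d : Cpx) : Prop :=
  derivable_pt_lim (fun s => fst (F s)) t (fst d) /\
  derivable_pt_lim (fun s => snd (F s)) t (snd d).

Definition C_differentiable_at (F : R -> Cpx) (t : R) : Prop :=
  exists d, C_deriv_at F t d.

Definition MTM_eq1 (h : R) (Un dUn Rn Rn1 Qn Qn1 : Cpx) : Prop :=
  RtoC 4 *c Ci *c dUn +c Qn1 +c Qn
  +c (RtoC 2 *c Ci /c RtoC h) *c (Rn1 -c Rn)
  +c Un *c Un *c (Cconj Rn +c Cconj Rn1)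
  -c Un *c (|Qn1|^2 +c |Qn|^2 +c |Rn1|^2 +c |Rn|^2)
  -c (Ci *c RtoC h /c RtoC 2) *c Un *c Un *c (Cconj Qn1 -c Cconj Qn)
  = C0.

Definition MTM_eq2 (h : R) (Un Qn Qn1 : Cpx) : Prop :=
  -c (RtoC 2 *c Ci /c RtoC h) *c (Qn1 -c Qn) +c RtoC 2 *c Un
  -c |Un|^2 *c (Qn1 +c Qn) = C0.

Definition MTM_eq3 (h : R) (Un Rn Rn1 : Cpx) : Prop :=
  Rn1 +c Rn -c RtoC 2 *c Un
  +c (Ci *c RtoC h /c RtoC 2) *c |Un|^2 *c (Rn1 -c Rn) = C0.

Definition MTM_at (h : R) (U Rf Q : Z -> R -> Cpx) (n : Z) (t : R) : Prop :=
  C_differentiable_at (U n) t /\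
  C_differentiable_at (Rf n) t /\
  C_differentiable_at (Q n) t /\
  (exists dU, C_deriv_at (U n) t dU /\
     MTM_eq1 h (U n t) dU (Rf n t) (Rf (n+1)%Z t) (Q n t) (Q (n+1)%Z t)) /\
  MTM_eq2 h (U n t) (Q n t) (Q (n+1)%Z t) /\
  MTM_eq3 h (U n t) (Rf n t) (Rf (n+1)%Z t).

Definition MTM_solution (h : R) (U Rf Q : Z -> R -> Cpx) : Prop :=
  forall n t, MTM_at h U Rf Q n t.

Definition S_of (h : R) (Un : Cpx) : Cpx :=
  (C1 +c (Ci /c RtoC 2) *c RtoC h *c |Un|^2) /c
  (C1 -c (Ci /c RtoC 2) *c RtoC h *c |Un|^2).

Definition Nden (h : R) (Un : Cpx) : Cpx := C1 -c (Ci /c RtoC 2) *c RtoC h *c |Un|^2.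

Definition N11 h lam Un := lam +c (RtoC 2 *c Ci /c (RtoC h *c lam)) *c S_of h Un.
Definition N12 h (lam : Cpx) Un := RtoC 2 *c Un /c Nden h Un.
Definition N21 h (lam : Cpx) Un := RtoC 2 *c Cconj Un /c Nden h Un.
Definition N22 h lam Un := (RtoC 2 *c Ci /c (RtoC h *c lam)) -c lam *c S_of h Un.

Definition P11 (lam Rn : Cpx) := (Ci /c RtoC 2) *c (lam *c lam -c |Rn|^2).
Definition P12 (lam Rn Qn : Cpx) := (Ci /c RtoC 2) *c (lam *c Rn -c Qn /c lam).
Definition P21 (lam Rn Qn : Cpx) :=
  (Ci /c RtoC 2) *c (lam *c Cconj Rn -c Cconj Qn /c lam).
Definition P22 (lam Qn : Cpx) := (Ci /c RtoC 2) *c (|Qn|^2 -c C1 /c (lam *c lam)).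

Definition Lax_at (h : R) (lam : Cpx) (U Rf Q f g : Z -> R -> Cpx) (n : Z) (t : R)
  : Prop :=
  f (n+1)%Z t = N11 h lam (U n t) *c f n t +c N12 h lam (U n t) *c g n t /\
  g (n+1)%Z t = N21 h lam (U n t) *c f n t +c N22 h lam (U n t) *c g n t /\
  C_deriv_at (f n) t
    (P11 lam (Rf n t) *c f n t +c P12 lam (Rf n t) (Q n t) *c g n t) /\
  C_deriv_at (g n) t
    (P21 lam (Rf n t) (Q n t) *c f n t +c P22 lam (Q n t) *c g n t).

Definition Lax_solution (h : R) (lam : Cpx) (U Rf Q f g : Z -> R -> Cpx) : Prop :=
  forall n t, Lax_at h lam U Rf Q f g n t.

Section Darboux.
Variables (h : R) (lam : Cpx) (U Rf Q f g : Z -> R -> Cpx).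
Let lb := Cconj lam.
Let al2 := |lam|^2.
Let F n t := |f n t|^2.
Let G n t := |g n t|^2.
Let dl := lam *c lam -c lb *c lb.

Definition Udt_num (n : Z) (t : R) : Cpx :=
  RtoC 2 *c Ci *c (lb *c F n t +c lam *c G n t) *c U n t
  -c RtoC h *c al2 *c (lam *c F n t +c lb *c G n t) *c U n t
  +c RtoC 2 *c Ci *c dl *c f n t *c Cconj (g n t).

Definition Udt_den (n : Z) (t : R) : Cpx :=
  RtoC 2 *c Ci *c (lam *c F n t +c lb *c G n t)
  -c RtoC h *c al2 *c (lb *c F n t +c lam *c G n t)
  +c RtoC h *c dl *c Cconj (f n t) *c g n t *c U n t.

Definition Rdt_num (n : Z) (t : R) : Cpx :=
  (lb *c F n t +c lam *c G n t) *c Rf n t +c dl *c f n t *c Cconj (g n t).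

Definition Rdt_den (n : Z) (t : R) : Cpx := lam *c F n t +c lb *c G n t.

Definition Qdt_num (n : Z) (t : R) : Cpx :=
  al2 *c (lam *c F n t +c lb *c G n t) *c Q n t +c dl *c f n t *c Cconj (g n t).

Definition Qdt_den (n : Z) (t : R) : Cpx := al2 *c (lb *c F n t +c lam *c G n t).

Definition Udt (n : Z) (t : R) : Cpx := -c (Udt_num n t /c Udt_den n t).
Definition Rdt (n : Z) (t : R) : Cpx := -c (Rdt_num n t /c Rdt_den n t).
Definition Qdt (n : Z) (t : R) : Cpx := -c (Qdt_num n t /c Qdt_den n t).
End Darboux.

(* Main.v *)
(* Put k = ih/2, so that conjugation is k -> -k and 2i/h = -1/k, and measure
   time derivatives as 4i d/dt; then i disappears from the system.  Given the
   two algebraic equations, which express Q_(n+1) and R_(n+1) through site n,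
   the first equation becomes 4i dU/dt = flow(U, R, Q) at site n alone, with
   [flow] polynomial in the potentials and their conjugates.

   The transformation depends on Phi only through D = lam|f|^2 + conj(lam)|g|^2,
   its conjugate Db, p = (lam^2 - conj(lam)^2) f conj(g) and its conjugate pb.
   These are related by
     p pb = |lam|^2 (D^2 + Db^2) - (lam^2 + conj(lam)^2) D Db,
   and the Lax pair acts linearly on (D, Db, p, pb), in n as well as in t.
   After elimination of lam^2 + conj(lam)^2 by this relation, each equation of
   the transformed system is an identity of rational functions. *)
(* [Defs] must come after [Reals], which also exports a [C1]. *)
From Stdlib Require Import Reals ZArith Lra Field.
Require Import Defs.
Open Scope R_scope.

(** * Field structure and conjugation on pairs of reals *)

Lemma Cpx_ext (z w : Cpx) : fst z = fst w -> snd z = snd w -> z = w.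
Proof. destruct z, w; simpl; congruence. Qed.

Lemma Cnorm2_neq0 (z : Cpx) : z <> C0 -> Cnorm2 z <> 0.
Proof.
  intros hz e; apply hz; unfold Cnorm2 in e.
  apply Cpx_ext; simpl; nra.
Qed.

Lemma Cpx_field_theory :
  field_theory C0 C1 Cplus Cmult Cminus Copp Cdiv Cinv (@eq Cpx).
Proof.
  constructor; [constructor| | |]; intros; try reflexivity;
    try (apply Cpx_ext; simpl; ring).
  - intro e; apply (f_equal fst) in e; simpl in e; lra.
  - apply Cnorm2_neq0 in H.
    apply Cpx_ext; simpl; unfold Cnorm2 in *; field; exact H.
Qed.

Add Field Cpx_field : Cpx_field_theory.

Lemma Cmult_integral (z w : Cpx) : z *c w = C0 -> z <> C0 -> w = C0.
Proof.
  intros e hz. replace w with ((z *c w) /c z) by (field; exact hz).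
  rewrite e; field; exact hz.
Qed.

Lemma Cmult_neq0 (z w : Cpx) : z <> C0 -> w <> C0 -> z *c w <> C0.
Proof. intros hz hw e; apply hw; exact (Cmult_integral z w e hz). Qed.

Lemma Cmult_neq0_inv (z w : Cpx) : z *c w <> C0 -> z <> C0 /\ w <> C0.
Proof. intros H; split; intros e; apply H; rewrite e; ring. Qed.

Lemma Cmult_cancel (c z w : Cpx) : c <> C0 -> c *c z = c *c w -> z = w.
Proof.
  intros hc e. replace z with ((c *c z) /c c) by (field; exact hc).
  rewrite e; field; exact hc.
Qed.

Lemma Copp_neq0 (z : Cpx) : z <> C0 -> -c z <> C0.
Proof. intros hz e; apply hz; replace z with (-c -c z) by ring; rewrite e; ring. Qed.

(** Serves the quotient rule for the transformed U, whose numerator and denominator share the factor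
    2i. *)
Lemma Copp_div_scale (c x y z w : Cpx) : c <> C0 -> w <> C0 ->
  -c ((c *c x *c (c *c w) -c c *c z *c (c *c y)) /c (c *c w *c (c *c w))) =
  -c ((x *c w -c z *c y) /c (w *c w)).
Proof. intros; field; auto. Qed.

Lemma Cconj_plus (z w : Cpx) : Cconj (z +c w) = Cconj z +c Cconj w.
Proof. apply Cpx_ext; simpl; ring. Qed.

Lemma Cconj_opp (z : Cpx) : Cconj (-c z) = -c Cconj z.
Proof. apply Cpx_ext; simpl; ring. Qed.

Lemma Cconj_minus (z w : Cpx) : Cconj (z -c w) = Cconj z -c Cconj w.
Proof. apply Cpx_ext; simpl; ring. Qed.

Lemma Cconj_mult (z w : Cpx) : Cconj (z *c w) = Cconj z *c Cconj w.
Proof. apply Cpx_ext; simpl; ring. Qed.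

Lemma Cconj_inv (z : Cpx) : Cconj (Cinv z) = Cinv (Cconj z).
Proof.
  apply Cpx_ext; simpl; unfold Rdiv, Cnorm2; simpl;
    rewrite ?Rmult_opp_opp; ring.
Qed.

Lemma Cconj_div (z w : Cpx) : Cconj (z /c w) = Cconj z /c Cconj w.
Proof. unfold Cdiv; rewrite Cconj_mult, Cconj_inv; reflexivity. Qed.

Lemma Cconj_involutive (z : Cpx) : Cconj (Cconj z) = z.
Proof. apply Cpx_ext; simpl; ring. Qed.

Lemma Cconj_RtoC (x : R) : Cconj (RtoC x) = RtoC x.
Proof. apply Cpx_ext; simpl; ring. Qed.

Lemma Cconj_C1 : Cconj C1 = C1.
Proof. exact (Cconj_RtoC 1). Qed.

Lemma Cconj_Ci : Cconj Ci = -c Ci.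
Proof. apply Cpx_ext; simpl; ring. Qed.

Lemma Cconj_neq0 (z : Cpx) : z <> C0 -> Cconj z <> C0.
Proof.
  intros hz e; apply hz. rewrite <- (Cconj_involutive z), e.
  apply Cpx_ext; simpl; ring.
Qed.

Lemma RtoC_Cnorm2 (z : Cpx) : RtoC (Cnorm2 z) = z *c Cconj z.
Proof. apply Cpx_ext; unfold Cnorm2; simpl; ring. Qed.

Lemma RtoC_2 : RtoC 2 = C1 +c C1.
Proof. apply Cpx_ext; simpl; ring. Qed.

Lemma RtoC_neq0 (x : R) : x <> 0 -> RtoC x <> C0.
Proof. intros hx e; apply hx; exact (f_equal fst e). Qed.

Lemma Ci_neq0 : Ci <> C0.
Proof. intro e; apply (f_equal snd) in e; simpl in e; lra. Qed.

Lemma two_neq0 : C1 +c C1 <> C0.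
Proof. rewrite <- RtoC_2; apply RtoC_neq0; lra. Qed.

Create HintDb Cconj.
#[export] Hint Rewrite Cconj_plus Cconj_opp Cconj_minus Cconj_mult Cconj_div
  Cconj_involutive Cconj_RtoC Cconj_C1 Cconj_Ci : Cconj.

(** * Rational-function identities behind the transformation *)

Definition two : Cpx := C1 +c C1.

(* The conjugates [ub], [rb], [qb], and below [Db], [pb], are independent
   variables, so that the identities are ones of rational functions. *)
Definition flow (k u ub r rb q qb : Cpx) : Cpx :=
  two *c ((k +c C1 /c k) *c u -c q -c r /c k -c u *c u *c rb -c k *c u *c u *c qb
          +c u *c (q *c qb +c r *c rb)).

(* The numerators and denominators of U are divided by 2i; conjugating one of
   these expressions means replacing k by -k and exchanging D, p with Db, pb. *)
Definition darboux_den k al D Db pb u := D +c k *c al *c Db +c k *c pb *c u.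
Definition darboux_num k al D Db p u := (Db +c k *c al *c D) *c u +c p.
Definition darboux_R D Db p r := -c ((Db *c r +c p) /c D).
Definition darboux_Q al D Db p q := -c ((D *c q +c p /c al) /c Db).

(** The right side is the first equation solved for 4i dU/dt. Once the values at site n+1 are
    substituted, the factors [a] and [ab] cancel from the denominators, which makes [flow]
    polynomial in the potentials. *)
Lemma flow_eq (k u ub r rb r1 rb1 q qb q1 qb1 : Cpx) :
  let a := C1 -c k *c (u *c ub) in
  let ab := C1 +c k *c (u *c ub) in
  k <> C0 -> a <> C0 -> ab <> C0 ->
  q1 = (q *c ab -c two *c k *c u) /c a ->
  qb1 = (qb *c a +c two *c k *c ub) /c ab ->
  r1 = (two *c u -c r *c a) /c ab ->
  rb1 = (two *c ub -c rb *c ab) /c a ->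
  flow k u ub r rb q qb =
    (r1 -c r) /c k -c (q1 +c q) -c u *c u *c (rb +c rb1)
    +c u *c (q1 *c qb1 +c q *c qb +c r1 *c rb1 +c r *c rb)
    +c k *c u *c u *c (qb1 -c qb).
Proof.
  intros a ab hk ha hab -> -> -> ->; unfold flow, two, a, ab in *.
  field; auto.
Qed.

(** [L] and [Lb] stand for lam^2 and its conjugate. The hypotheses on [dD], [dDb], [dp], [dpb] are
    the evolution under the Lax pair; the left side of the conclusion is the quotient rule for the
    transformed U. *)
Lemma darboux_flow (k al L Lb D Db p pb u ub r rb q qb dD dDb dp dpb du : Cpx) :
  let s := L +c Lb in
  let A := darboux_den k al D Db pb u in
  let Ab := darboux_den (-c k) al Db D p ub in
  let B := darboux_num k al D Db p u in
  let Bb := darboux_num (-c k) al Db D pb ub in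
  k <> C0 -> al <> C0 -> D <> C0 -> Db <> C0 -> A <> C0 -> Ab <> C0 ->
  p *c pb = al *c (D *c D +c Db *c Db) -c s *c D *c Db ->
  dD = two *c ((al -c C1 /c al) *c Db -c (L -c Lb /c (al *c al)) *c D
         +c r *c pb -c qb /c al *c p) ->
  dDb = two *c ((Lb -c L /c (al *c al)) *c Db -c (al -c C1 /c al) *c D
         -c rb *c p +c q /c al *c pb) ->
  dp = two *c ((r *c rb +c q *c qb -c L -c L /c (al *c al)) *c p
        +c r *c (two *c al *c D -c s *c Db) -c q /c al *c (s *c D -c two *c al *c Db)) ->
  dpb = two *c ((Lb +c Lb /c (al *c al) -c r *c rb -c q *c qb) *c pb
        -c rb *c (two *c al *c Db -c s *c D) +c qb /c al *c (s *c Db -c two *c al *c D)) ->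
  du = flow k u ub r rb q qb ->
  let dB := (dDb +c k *c al *c dD) *c u +c (Db +c k *c al *c D) *c du +c dp in
  let dA := dD +c k *c al *c dDb +c k *c (dpb *c u +c pb *c du) in
  -c ((dB *c A -c B *c dA) /c (A *c A)) =
  flow k (-c (B /c A)) (-c (Bb /c Ab))
    (darboux_R D Db p r) (darboux_R Db D pb rb)
    (darboux_Q al D Db p q) (darboux_Q al Db D pb qb).
Proof.
  intros s A Ab B Bb hk hal hD hDb hA hAb H -> -> -> -> ->.
  (* The quadratic relation ties [L] and [Lb] only through their sum; solving it for [Lb] leaves
     independent variables. *)
  assert (e : Lb = (al *c (D *c D +c Db *c Db) -c p *c pb) /c (D *c Db) -c L).
  { rewrite H; unfold s; field; auto. }
  clear H. unfold s in *; clear s; subst Lb.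
  unfold flow, darboux_R, darboux_Q, A, Ab, B, Bb, darboux_den, darboux_num, two in *.
  cbv zeta.
  field; repeat split; auto.
Qed.

(** N_n acts linearly on products of an entry of Phi with a conjugate entry. [c] is the product of
    [k *c l *c a], the denominator of [f1] and [g1], with its conjugate. The combination
    [s *c D -c two *c al *c Db] is dl (l |f|^2 - lb |g|^2), and [two *c al *c D -c s *c Db] is dl
    (lb |f|^2 - l |g|^2). Three formulas suffice, since the transformed R and Q at site n+1 involve
    only D, Db and p there. *)
Lemma shift_quadratic (k l lb u ub f fb g gb f1 fb1 g1 gb1 : Cpx) :
  let a := C1 -c k *c (u *c ub) in
  let ab := C1 +c k *c (u *c ub) in
  let al := l *c lb in
  let dl := l *c l -c lb *c lb in
  let s := l *c l +c lb *c lb in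
  let D := l *c (f *c fb) +c lb *c (g *c gb) in
  let Db := lb *c (f *c fb) +c l *c (g *c gb) in
  let p := dl *c f *c gb in
  let pb := -c dl *c fb *c g in
  let c := -c (k *c k *c al *c a *c ab) in
  k <> C0 -> l <> C0 -> lb <> C0 -> a <> C0 -> ab <> C0 ->
  f1 = (two *c k *c l *c u *c g -c (ab -c k *c l *c l *c a) *c f) /c (k *c l *c a) ->
  g1 = (two *c k *c l *c ub *c f -c (a +c k *c l *c l *c ab) *c g) /c (k *c l *c a) ->
  fb1 = ((a +c k *c lb *c lb *c ab) *c fb +c two *c k *c lb *c ub *c gb) /c (k *c lb *c ab) ->
  gb1 = ((ab -c k *c lb *c lb *c a) *c gb +c two *c k *c lb *c u *c fb) /c (k *c lb *c ab) ->
  c *c (l *c (f1 *c fb1) +c lb *c (g1 *c gb1)) =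
    a *c ((C1 -c k *c k *c al *c al) *c ab *c D -c k *c a *c (s *c D -c two *c al *c Db)
          -c two *c k *c k *c al *c ub *c p +c two *c k *c u *c pb) /\
  c *c (lb *c (f1 *c fb1) +c l *c (g1 *c gb1)) =
    ab *c ((C1 -c k *c k *c al *c al) *c a *c Db +c k *c ab *c (s *c Db -c two *c al *c D)
          -c two *c k *c k *c al *c u *c pb -c two *c k *c ub *c p) /\
  c *c (dl *c f1 *c gb1) =
    (ab *c ab -c k *c s *c a *c ab +c k *c k *c al *c al *c a *c a) *c p
    +c two *c two *c k *c k *c al *c u *c u *c pb
    +c two *c k *c u *c (ab *c (two *c al *c D -c s *c Db)
                         -c al *c k *c a *c (s *c D -c two *c al *c Db)).
Proof.
  intros a ab al dl s D Db p pb c hk hl hlb ha hab -> -> -> ->.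
  unfold c, D, Db, p, pb, dl, s, al, two.
  repeat split; unfold a, ab in *; (field; repeat split; auto).
Qed.

(** The conclusions are cross-multiplied as in [MTM_eq2_iff] and [MTM_eq3_iff]; the hypotheses on
    [D1], [Db1], [p1] are what [shift_quadratic] provides. *)
Lemma darboux_shift (k al s D Db p pb u ub r r1 q q1 D1 Db1 p1 : Cpx) :
  let a := C1 -c k *c (u *c ub) in
  let ab := C1 +c k *c (u *c ub) in
  let A := darboux_den k al D Db pb u in
  let Ab := darboux_den (-c k) al Db D p ub in
  let B := darboux_num k al D Db p u in
  let Bb := darboux_num (-c k) al Db D pb ub in
  let v := -c (B /c A) in
  let vb := -c (Bb /c Ab) in
  let c := -c (k *c k *c al *c a *c ab) in
  k <> C0 -> al <> C0 -> D <> C0 -> Db <> C0 -> A <> C0 -> Ab <> C0 ->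
  a <> C0 -> ab <> C0 -> D1 <> C0 -> Db1 <> C0 ->
  p *c pb = al *c (D *c D +c Db *c Db) -c s *c D *c Db ->
  q1 = (q *c ab -c two *c k *c u) /c a ->
  r1 = (two *c u -c r *c a) /c ab ->
  c *c D1 =
    a *c ((C1 -c k *c k *c al *c al) *c ab *c D -c k *c a *c (s *c D -c two *c al *c Db)
          -c two *c k *c k *c al *c ub *c p +c two *c k *c u *c pb) ->
  c *c Db1 =
    ab *c ((C1 -c k *c k *c al *c al) *c a *c Db +c k *c ab *c (s *c Db -c two *c al *c D)
          -c two *c k *c k *c al *c u *c pb -c two *c k *c ub *c p) ->
  c *c p1 =
    (ab *c ab -c k *c s *c a *c ab +c k *c k *c al *c al *c a *c a) *c p
    +c two *c two *c k *c k *c al *c u *c u *c pb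
    +c two *c k *c u *c (ab *c (two *c al *c D -c s *c Db)
                         -c al *c k *c a *c (s *c D -c two *c al *c Db)) ->
  darboux_Q al D1 Db1 p1 q1 *c (C1 -c k *c (v *c vb)) =
    darboux_Q al D Db p q *c (C1 +c k *c (v *c vb)) -c two *c k *c v /\
  darboux_R D1 Db1 p1 r1 *c (C1 +c k *c (v *c vb)) =
    two *c v -c darboux_R D Db p r *c (C1 -c k *c (v *c vb)).
Proof.
  intros a ab A Ab B Bb v vb c hk hal hD hDb hA hAb ha hab hD1 hDb1 H -> ->
    e1 e2 e3.
  assert (hc : c <> C0).
  { apply Copp_neq0; repeat apply Cmult_neq0; assumption. }
  assert (es : s = (al *c (D *c D +c Db *c Db) -c p *c pb) /c (D *c Db)).
  { rewrite H; field; auto. }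
  clear H; subst s.
  (* [c D1] and [c Db1] factor through [1 + k v vb] and [1 - k v vb], where
     [v] is the transformed [U]. *)
  assert (e1' : D1 = a *c (A *c Ab +c k *c B *c Bb) /c (Db *c c)).
  { apply (Cmult_cancel c); [exact hc|]; rewrite e1.
    unfold A, Ab, B, Bb, darboux_den, darboux_num, two, a, ab in *.
    field; repeat split; auto. }
  assert (e2' : Db1 = ab *c (A *c Ab -c k *c B *c Bb) /c (D *c c)).
  { apply (Cmult_cancel c); [exact hc|]; rewrite e2.
    unfold A, Ab, B, Bb, darboux_den, darboux_num, two, a, ab in *.
    field; repeat split; auto. }
  (* [D1] and [Db1] are denominators of the transformed R and Q at site n+1. After substitution
     these two factors stand there instead, and [field] needs them nonzero. *)
  assert (h1 : A *c Ab +c k *c B *c Bb <> C0).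
  { intro e; apply hD1; rewrite e1', e; field; auto. }
  assert (h2 : A *c Ab -c k *c B *c Bb <> C0).
  { intro e; apply hDb1; rewrite e2', e; field; auto. }
  match type of e3 with _ = ?X => assert (e3' : p1 = X /c c) end.
  { apply (Cmult_cancel c); [exact hc|]; rewrite e3. field; repeat split; auto. }
  clear e1 e2 e3 hD1 hDb1. subst D1 Db1 p1.
  unfold v, vb, darboux_Q, darboux_R, c in *; clear v vb c.
  unfold A, Ab, B, Bb, darboux_den, darboux_num, two, a, ab in *.
  clear A Ab B Bb a ab.
  split; field; repeat split; auto.
Qed.

(** * Differentiation of complex-valued functions of a real variable *)

Lemma C_deriv_at_ext (F G : R -> Cpx) (t : R) (d : Cpx) :
  (forall s, F s = G s) -> C_deriv_at F t d -> C_deriv_at G t d.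
Proof.
  (* The limit is unfolded so that only values are rewritten, without function extensionality. *)
  intros e [h1 h2]; split; intros eps heps.
  - destruct (h1 eps heps) as [del H]; exists del; intros; rewrite <- !e; auto.
  - destruct (h2 eps heps) as [del H]; exists del; intros; rewrite <- !e; auto.
Qed.

Lemma C_deriv_at_const (c : Cpx) (t : R) : C_deriv_at (fun _ => c) t C0.
Proof. split; apply derivable_pt_lim_const. Qed.

Lemma C_deriv_at_plus (F G : R -> Cpx) (t : R) (dF dG : Cpx) :
  C_deriv_at F t dF -> C_deriv_at G t dG ->
  C_deriv_at (fun s => F s +c G s) t (dF +c dG).
Proof.
  intros [hF1 hF2] [hG1 hG2]; split; simpl;
    [exact (derivable_pt_lim_plus _ _ _ _ _ hF1 hG1)
    |exact (derivable_pt_lim_plus _ _ _ _ _ hF2 hG2)].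
Qed.

Lemma C_deriv_at_mult (F G : R -> Cpx) (t : R) (dF dG : Cpx) :
  C_deriv_at F t dF -> C_deriv_at G t dG ->
  C_deriv_at (fun s => F s *c G s) t (dF *c G t +c F t *c dG).
Proof.
  intros [hF1 hF2] [hG1 hG2]; split; simpl.
  - replace (_ + _) with
      ((fst dF * fst (G t) + fst (F t) * fst dG)
       - (snd dF * snd (G t) + snd (F t) * snd dG)) by ring.
    exact (derivable_pt_lim_minus _ _ _ _ _
             (derivable_pt_lim_mult _ _ _ _ _ hF1 hG1)
             (derivable_pt_lim_mult _ _ _ _ _ hF2 hG2)).
  - replace (_ + _) with
      ((fst dF * snd (G t) + fst (F t) * snd dG)
       + (snd dF * fst (G t) + snd (F t) * fst dG)) by ring.
    exact (derivable_pt_lim_plus _ _ _ _ _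
             (derivable_pt_lim_mult _ _ _ _ _ hF1 hG2)
             (derivable_pt_lim_mult _ _ _ _ _ hF2 hG1)).
Qed.

Lemma C_deriv_at_conj (F : R -> Cpx) (t : R) (d : Cpx) :
  C_deriv_at F t d -> C_deriv_at (fun s => Cconj (F s)) t (Cconj d).
Proof.
  intros [h1 h2]; split; simpl;
    [exact h1 | exact (derivable_pt_lim_opp _ _ _ h2)].
Qed.

Lemma C_deriv_at_inv (F : R -> Cpx) (t : R) (d : Cpx) :
  C_deriv_at F t d -> F t <> C0 ->
  C_deriv_at (fun s => Cinv (F s)) t (-c (d /c (F t *c F t))).
Proof.
  intros [h1 h2] hF.
  pose proof (Cnorm2_neq0 _ hF) as hN.
  pose proof (derivable_pt_lim_plus _ _ _ _ _
                (derivable_pt_lim_mult _ _ _ _ _ h1 h1)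
                (derivable_pt_lim_mult _ _ _ _ _ h2 h2)) as hd.
  (* The claimed value divides by the square of [F t], whose squared modulus [field] therefore meets
     as a denominator. *)
  assert (hN2 : Cnorm2 (F t *c F t) <> 0)
    by (apply Cnorm2_neq0, Cmult_neq0; exact hF).
  split; simpl.
  - pose proof (derivable_pt_lim_div _ _ _ _ _ h1 hd hN) as H.
    match type of H with derivable_pt_lim _ _ ?X => replace (- _) with X; [exact H|] end.
    unfold plus_fct, mult_fct, Cnorm2, Rsqr in *; simpl in *; field; auto.
  - pose proof (derivable_pt_lim_div _ _ _ _ _ (derivable_pt_lim_opp _ _ _ h2) hd hN) as H.
    match type of H with derivable_pt_lim _ _ ?X => replace (- _) with X; [exact H|] end.
    unfold plus_fct, mult_fct, opp_fct, Cnorm2, Rsqr in *; simpl in *; field; auto.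
Qed.

(** * The normalised derivative 4i d/dt *)

Definition four_i : Cpx := RtoC 4 *c Ci.

Lemma four_i_neq0 : four_i <> C0.
Proof. apply Cmult_neq0; [|exact Ci_neq0]; apply RtoC_neq0; lra. Qed.

Lemma Cconj_four_i : Cconj four_i = -c four_i.
Proof. unfold four_i; autorewrite with Cconj; ring. Qed.

(** Absorbing 4i here frees the evolution laws of [Ci]. Being a relation, it also records
    differentiability. *)
Definition dot (F : R -> Cpx) (t : R) (d : Cpx) : Prop := C_deriv_at F t (d /c four_i).

Lemma dot_eq (F : R -> Cpx) (t : R) (d d' : Cpx) : d = d' -> dot F t d -> dot F t d'.
Proof. intros ->; trivial. Qed.

Lemma dot_ext (F G : R -> Cpx) (t : R) (d : Cpx) :
  (forall s, F s = G s) -> dot F t d -> dot G t d.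
Proof. apply C_deriv_at_ext. Qed.

Lemma C_deriv_at_dot (F : R -> Cpx) (t : R) (d : Cpx) :
  C_deriv_at F t d -> dot F t (four_i *c d).
Proof.
  unfold dot; replace (four_i *c d /c four_i) with d by (field; exact four_i_neq0); trivial.
Qed.

Lemma dot_differentiable (F : R -> Cpx) (t : R) (d : Cpx) :
  dot F t d -> C_differentiable_at F t.
Proof. intro H; exists (d /c four_i); exact H. Qed.

Lemma dot_const (c : Cpx) (t : R) : dot (fun _ => c) t C0.
Proof.
  unfold dot; replace (C0 /c four_i) with C0 by (field; exact four_i_neq0).
  apply C_deriv_at_const.
Qed.

Lemma dot_plus (F G : R -> Cpx) (t : R) (dF dG : Cpx) :
  dot F t dF -> dot G t dG -> dot (fun s => F s +c G s) t (dF +c dG).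
Proof.
  unfold dot; intros hF hG.
  replace ((dF +c dG) /c four_i) with (dF /c four_i +c dG /c four_i) by (field; exact four_i_neq0).
  exact (C_deriv_at_plus _ _ _ _ _ hF hG).
Qed.

Lemma dot_mult (F G : R -> Cpx) (t : R) (dF dG : Cpx) :
  dot F t dF -> dot G t dG ->
  dot (fun s => F s *c G s) t (dF *c G t +c F t *c dG).
Proof.
  unfold dot; intros hF hG.
  replace ((dF *c G t +c F t *c dG) /c four_i)
    with (dF /c four_i *c G t +c F t *c (dG /c four_i)) by (field; exact four_i_neq0).
  exact (C_deriv_at_mult _ _ _ _ _ hF hG).
Qed.

Lemma dot_scale (c : Cpx) (F : R -> Cpx) (t : R) (dF : Cpx) :
  dot F t dF -> dot (fun s => c *c F s) t (c *c dF).
Proof.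
  intros hF; eapply dot_eq; [|exact (dot_mult _ _ _ _ _ (dot_const c t) hF)].
  cbv beta; ring.
Qed.

(** The minus sign arises because 4i changes sign under conjugation. *)
Lemma dot_conj (F : R -> Cpx) (t : R) (d : Cpx) :
  dot F t d -> dot (fun s => Cconj (F s)) t (-c Cconj d).
Proof.
  unfold dot; intros h.
  replace (-c Cconj d /c four_i) with (Cconj (d /c four_i)).
  - exact (C_deriv_at_conj _ _ _ h).
  - rewrite Cconj_div, Cconj_four_i; field; pose proof four_i_neq0 as hi; repeat split; auto.
    intro e; apply hi; replace four_i with (-c -c four_i) by ring; rewrite e; ring.
Qed.

Lemma dot_opp_div (F G : R -> Cpx) (t : R) (dF dG : Cpx) :
  dot F t dF -> dot G t dG -> G t <> C0 ->
  dot (fun s => -c (F s /c G s)) t (-c ((dF *c G t -c F t *c dG) /c (G t *c G t))).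
Proof.
  intros hF hG hGt.
  assert (hI : dot (fun s => Cinv (G s)) t (-c (dG /c (G t *c G t)))).
  { unfold dot in *.
    replace (-c (dG /c (G t *c G t)) /c four_i) with (-c (dG /c four_i /c (G t *c G t)))
      by (field; auto using four_i_neq0).
    exact (C_deriv_at_inv _ _ _ hG hGt). }
  apply dot_ext with (F := fun s => (-c C1) *c (F s *c Cinv (G s))).
  - intro s; unfold Cdiv; ring.
  - eapply dot_eq; [|exact (dot_scale (-c C1) _ _ _ (dot_mult _ _ _ _ _ hF hI))].
    cbv beta; field; auto.
Qed.

(** * The semi-discrete system in terms of k = ih/2 *)

Definition kap (h : R) : Cpx := Ci *c RtoC h /c RtoC 2.

Lemma kap_neq0 (h : R) : h <> 0 -> kap h <> C0.
Proof.
  intros hh e; apply (f_equal snd) in e; revert e; unfold kap, Cdiv, Cinv, Cnorm2; simpl.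
  intro e; apply hh; field_simplify in e; lra.
Qed.

Lemma Cconj_kap (h : R) : Cconj (kap h) = -c kap h.
Proof.
  unfold kap; autorewrite with Cconj. field; apply RtoC_neq0; lra.
Qed.

Lemma two_i_div_h (h : R) : h <> 0 -> RtoC 2 *c Ci /c RtoC h = -c (C1 /c kap h).
Proof.
  intro hh; pose proof (kap_neq0 h hh) as hk.
  apply (Cmult_cancel (kap h)); [exact hk|].
  transitivity (Ci *c Ci).
  - unfold kap; field; split; apply RtoC_neq0; lra.
  - transitivity (-c C1); [|field; exact hk].
    apply Cpx_ext; simpl; ring.
Qed.

(** [kap h] is purely imaginary, so the real part is 1. *)
Lemma one_minus_kap_neq0 (h x : R) : C1 -c kap h *c RtoC x <> C0.
Proof.
  intro e; apply (f_equal fst) in e; revert e; unfold kap, Cdiv, Cinv, Cnorm2; simpl; lra.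
Qed.

Lemma one_plus_kap_neq0 (h x : R) : C1 +c kap h *c RtoC x <> C0.
Proof.
  intro e; apply (f_equal fst) in e; revert e; unfold kap, Cdiv, Cinv, Cnorm2; simpl; lra.
Qed.

Lemma Cminus_eq (z w : Cpx) : z -c w = C0 <-> z = w.
Proof.
  split; [|intros ->; ring].
  intro e; replace z with ((z -c w) +c w) by ring; rewrite e; ring.
Qed.

(** Multiplying by the nonzero k gives a recursion linear in q. It stays cross-multiplied, so no
    division is involved in either direction. *)
Lemma MTM_eq2_iff (h : R) (u q q1 : Cpx) : h <> 0 ->
  MTM_eq2 h u q q1 <->
  q1 *c (C1 -c kap h *c (u *c Cconj u)) =
    q *c (C1 +c kap h *c (u *c Cconj u)) -c two *c kap h *c u.
Proof.
  intro hh; pose proof (kap_neq0 h hh) as hk.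
  unfold MTM_eq2; rewrite (two_i_div_h h hh), RtoC_Cnorm2, RtoC_2; fold two.
  rewrite <- (Cminus_eq (q1 *c _)).
  replace (_ -c (q *c _ -c _)) with
    (kap h *c (-c -c (C1 /c kap h) *c (q1 -c q) +c two *c u -c u *c Cconj u *c (q1 +c q)))
    by (field; exact hk).
  split; intro e; [rewrite e; ring | exact (Cmult_integral _ _ e hk)].
Qed.

Lemma MTM_eq3_iff (h : R) (u r r1 : Cpx) :
  MTM_eq3 h u r r1 <->
  r1 *c (C1 +c kap h *c (u *c Cconj u)) =
    two *c u -c r *c (C1 -c kap h *c (u *c Cconj u)).
Proof.
  unfold MTM_eq3; fold (kap h); rewrite RtoC_Cnorm2, RtoC_2; fold two.
  rewrite <- (Cminus_eq (r1 *c _)).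
  match goal with |- ?x = _ <-> ?y = _ => replace y with x by ring end.
  reflexivity.
Qed.

(** Read forwards for the given solution and backwards for the transformed one; [flow_eq] eliminates
    site n+1. *)
Lemma MTM_eq1_iff (h : R) (u du r r1 q q1 : Cpx) : h <> 0 ->
  MTM_eq2 h u q q1 -> MTM_eq3 h u r r1 ->
  MTM_eq1 h u du r r1 q q1 <->
  four_i *c du = flow (kap h) u (Cconj u) r (Cconj r) q (Cconj q).
Proof.
  intros hh e2 e3; pose proof (kap_neq0 h hh) as hk.
  apply MTM_eq2_iff in e2; [|exact hh]; apply MTM_eq3_iff in e3.
  pose proof (one_minus_kap_neq0 h (Cnorm2 u)) as ha.
  pose proof (one_plus_kap_neq0 h (Cnorm2 u)) as hab.
  rewrite RtoC_Cnorm2 in ha, hab.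
  (* Conjugating the two algebraic equations flips the sign of [kap h] and yields the conjugate
     values at site n+1 that [flow_eq] asks for. *)
  pose proof (f_equal Cconj e2) as e2c; pose proof (f_equal Cconj e3) as e3c.
  unfold two in e2c, e3c; autorewrite with Cconj in e2c, e3c.
  rewrite Cconj_kap in e2c, e3c; fold two in e2c, e3c.
  rewrite (flow_eq (kap h) u (Cconj u) r (Cconj r) r1 (Cconj r1) q (Cconj q) q1 (Cconj q1));
    try assumption.
  - unfold MTM_eq1; fold four_i; rewrite (two_i_div_h h hh), !RtoC_Cnorm2; fold (kap h).
    rewrite <- (Cminus_eq (four_i *c du)).
    match goal with |- ?x = _ <-> ?y = _ => replace y with x by (field; exact hk) end.
    reflexivity.
  - rewrite <- e2; field; exact ha.
  - apply (Cmult_cancel _ _ _ hab).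
    transitivity (Cconj q1 *c (C1 -c -c kap h *c (Cconj u *c u))); [ring|].
    rewrite e2c; field; exact hab.
  - rewrite <- e3; field; exact hab.
  - apply (Cmult_cancel _ _ _ ha).
    transitivity (Cconj r1 *c (C1 +c -c kap h *c (Cconj u *c u))); [ring|].
    rewrite e3c; field; exact ha.
Qed.

(** * The Lax pair in terms of k *)

Lemma Lax_at_dot (h : R) (lam : Cpx) (U Rf Q f g : Z -> R -> Cpx) (n : Z) (t : R) :
  lam <> C0 -> Lax_at h lam U Rf Q f g n t ->
  dot (f n) t (-c two *c ((lam *c lam -c Rf n t *c Cconj (Rf n t)) *c f n t
                          +c (lam *c Rf n t -c Q n t /c lam) *c g n t)) /\
  dot (g n) t (-c two *c ((lam *c Cconj (Rf n t) -c Cconj (Q n t) /c lam) *c f n t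
                          +c (Q n t *c Cconj (Q n t) -c C1 /c (lam *c lam)) *c g n t)).
Proof.
  intros hl (_ & _ & hf & hg).
  (* 4i times the prefactor i/2 of P_n is -2, so [Ci] drops out. *)
  assert (e : four_i *c (Ci /c RtoC 2) = -c two).
  { unfold four_i, two; rewrite RtoC_2.
    transitivity ((C1 +c C1) *c (Ci *c Ci)).
    - replace (RtoC 4) with ((C1 +c C1) *c (C1 +c C1)) by (apply Cpx_ext; simpl; ring).
      field; exact two_neq0.
    - apply Cpx_ext; simpl; ring. }
  apply C_deriv_at_dot in hf; apply C_deriv_at_dot in hg.
  unfold P11, P12 in hf; unfold P21, P22 in hg.
  rewrite RtoC_Cnorm2 in hf, hg.
  split; [eapply dot_eq; [|exact hf] | eapply dot_eq; [|exact hg]]; rewrite <- e; ring.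
Qed.

(** Since S_n is [ab /c a] and 2i/(h lam) is -1/(k lam), all entries of N_n have the common
    denominator [k *c lam *c a]. *)
Lemma Lax_at_shift (h : R) (lam : Cpx) (U Rf Q f g : Z -> R -> Cpx) (n : Z) (t : R) :
  h <> 0 -> lam <> C0 -> Lax_at h lam U Rf Q f g n t ->
  let k := kap h in
  let u := U n t in
  let a := C1 -c k *c (u *c Cconj u) in
  let ab := C1 +c k *c (u *c Cconj u) in
  f (n + 1)%Z t =
    (two *c k *c lam *c u *c g n t -c (ab -c k *c lam *c lam *c a) *c f n t)
      /c (k *c lam *c a) /\
  g (n + 1)%Z t =
    (two *c k *c lam *c Cconj u *c f n t -c (a +c k *c lam *c lam *c ab) *c g n t)
      /c (k *c lam *c a).
Proof.
  intros hh hl (hf & hg & _ & _) k u a ab.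
  pose proof (kap_neq0 h hh) as hk; fold k in hk.
  pose proof (one_minus_kap_neq0 h (Cnorm2 u)) as ha.
  rewrite RtoC_Cnorm2 in ha; fold k in ha.
  assert (h2 : RtoC 2 <> C0) by (apply RtoC_neq0; lra).
  assert (ek : Ci /c RtoC 2 *c RtoC h = k) by (unfold k, kap; field; exact h2).
  assert (hN : forall X, RtoC 2 *c Ci /c (RtoC h *c lam) *c X = -c (X /c (k *c lam))).
  { intro X. transitivity ((RtoC 2 *c Ci /c RtoC h) *c (X /c lam)).
    - field; split; [exact hl|apply RtoC_neq0; exact hh].
    - rewrite (two_i_div_h h hh); fold k; field; auto. }
  assert (hN1 : RtoC 2 *c Ci /c (RtoC h *c lam) = -c (C1 /c (k *c lam))).
  { rewrite <- hN; ring. }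
  unfold N11, N12, N21, N22, S_of, Nden in hf, hg.
  rewrite RtoC_Cnorm2, ek in hf, hg.
  rewrite hN, RtoC_2 in hf. rewrite hN1, RtoC_2 in hg.
  fold u in hf, hg; fold two in hf, hg.
  rewrite hf, hg; unfold a, ab; split; field; auto.
Qed.

(** * The transformed fields in terms of D, p and their conjugates *)

Section Transform.
Variables (h : R) (lam : Cpx) (U Rf Q f g : Z -> R -> Cpx).
Let lb := Cconj lam.
Let al := lam *c lb.
Let s := lam *c lam +c lb *c lb.
Let dl := lam *c lam -c lb *c lb.
Let k := kap h.
Let D n t := lam *c (f n t *c Cconj (f n t)) +c lb *c (g n t *c Cconj (g n t)).
Let Db n t := lb *c (f n t *c Cconj (f n t)) +c lam *c (g n t *c Cconj (g n t)).
Let p n t := dl *c f n t *c Cconj (g n t).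
Let pb n t := -c dl *c Cconj (f n t) *c g n t.

Lemma Cconj_D n t : Cconj (D n t) = Db n t.
Proof. unfold D, Db, lb; autorewrite with Cconj; ring. Qed.

Lemma Cconj_Db n t : Cconj (Db n t) = D n t.
Proof. rewrite <- Cconj_D; apply Cconj_involutive. Qed.

Lemma Cconj_p n t : Cconj (p n t) = pb n t.
Proof. unfold p, pb, dl, lb; autorewrite with Cconj; ring. Qed.

Lemma Cconj_pb n t : Cconj (pb n t) = p n t.
Proof. rewrite <- Cconj_p; apply Cconj_involutive. Qed.

Lemma Cconj_al : Cconj al = al.
Proof. unfold al, lb; autorewrite with Cconj; ring. Qed.

(** The right side factors as (lam D - lb Db)(lb D - lam Db), whose factors are dl |f|^2 and -dl
    |g|^2. *)
Lemma p_mul_pb n t :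
  p n t *c pb n t = al *c (D n t *c D n t +c Db n t *c Db n t) -c s *c D n t *c Db n t.
Proof. unfold p, pb, al, s, D, Db, dl; ring. Qed.

Lemma Rdt_den_eq n t : Rdt_den lam f g n t = D n t.
Proof. unfold Rdt_den; rewrite !RtoC_Cnorm2; reflexivity. Qed.

Lemma Rdt_num_eq n t : Rdt_num lam Rf f g n t = Db n t *c Rf n t +c p n t.
Proof. unfold Rdt_num; rewrite !RtoC_Cnorm2; reflexivity. Qed.

Lemma Rdt_eq n t : Rdt lam Rf f g n t = darboux_R (D n t) (Db n t) (p n t) (Rf n t).
Proof. unfold Rdt; rewrite Rdt_den_eq, Rdt_num_eq; reflexivity. Qed.

Lemma Qdt_den_eq n t : Qdt_den lam f g n t = al *c Db n t.
Proof. unfold Qdt_den; rewrite !RtoC_Cnorm2; reflexivity. Qed.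

(** Unlike [Qdt_eq], this holds at every time without conditions, as differentiation through
    [dot_ext] requires. *)
Lemma Qdt_eq_quotient n t :
  Qdt lam Q f g n t = -c ((al *c D n t *c Q n t +c p n t) /c (al *c Db n t)).
Proof. unfold Qdt, Qdt_den, Qdt_num; rewrite !RtoC_Cnorm2; reflexivity. Qed.

Lemma Qdt_eq n t : al <> C0 -> Db n t <> C0 ->
  Qdt lam Q f g n t = darboux_Q al (D n t) (Db n t) (p n t) (Q n t).
Proof.
  intros hal hD; rewrite Qdt_eq_quotient; unfold darboux_Q; field; auto.
Qed.

Lemma h_eq : RtoC h = -c (RtoC 2 *c Ci *c k).
Proof.
  unfold k, kap; transitivity (-c (Ci *c Ci *c RtoC h)).
  - apply Cpx_ext; simpl; ring.
  - field; apply RtoC_neq0; lra.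
Qed.

Lemma Udt_den_eq n t :
  Udt_den h lam U f g n t =
  RtoC 2 *c Ci *c darboux_den k al (D n t) (Db n t) (pb n t) (U n t).
Proof.
  unfold Udt_den, darboux_den; rewrite h_eq, !RtoC_Cnorm2.
  unfold D, Db, pb, dl, al, lb; ring.
Qed.

(** The factor 2i is left in place so that the equality holds at every time, even where the
    denominator vanishes. *)
Lemma Udt_eq_quotient n t :
  Udt h lam U f g n t =
  -c ((RtoC 2 *c Ci *c darboux_num k al (D n t) (Db n t) (p n t) (U n t))
      /c (RtoC 2 *c Ci *c darboux_den k al (D n t) (Db n t) (pb n t) (U n t))).
Proof.
  unfold Udt; rewrite Udt_den_eq; f_equal; f_equal.
  unfold Udt_num, darboux_num; rewrite h_eq, !RtoC_Cnorm2.
  unfold D, Db, p, dl, al, lb; ring.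
Qed.

(** The product rule applied to [Lax_at_dot]. The value 1/lam^2 is written [lb *c lb /c (al *c al)]
    to match [darboux_flow]. *)
Lemma dot_D n t : lam <> C0 -> Lax_at h lam U Rf Q f g n t ->
  dot (D n) t
   (two *c ((al -c C1 /c al) *c Db n t -c (lam *c lam -c lb *c lb /c (al *c al)) *c D n t
         +c Rf n t *c pb n t -c Cconj (Q n t) /c al *c p n t)).
Proof.
  intros hl hL; assert (hlb : lb <> C0) by (apply Cconj_neq0; exact hl).
  destruct (Lax_at_dot _ _ _ _ _ _ _ _ _ hl hL) as [hf hg].
  eapply dot_eq;
    [|exact (dot_plus _ _ _ _ _
        (dot_scale lam _ _ _ (dot_mult _ _ _ _ _ hf (dot_conj _ _ _ hf)))
        (dot_scale lb _ _ _ (dot_mult _ _ _ _ _ hg (dot_conj _ _ _ hg))))].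
  unfold two; autorewrite with Cconj.
  unfold D, Db, p, pb, dl, al; fold lb; field; auto.
Qed.

Lemma dot_p n t : lam <> C0 -> Lax_at h lam U Rf Q f g n t ->
  dot (p n) t
   (two *c ((Rf n t *c Cconj (Rf n t) +c Q n t *c Cconj (Q n t)
             -c lam *c lam -c lam *c lam /c (al *c al)) *c p n t
        +c Rf n t *c (two *c al *c D n t -c s *c Db n t)
        -c Q n t /c al *c (s *c D n t -c two *c al *c Db n t))).
Proof.
  intros hl hL; assert (hlb : lb <> C0) by (apply Cconj_neq0; exact hl).
  destruct (Lax_at_dot _ _ _ _ _ _ _ _ _ hl hL) as [hf hg].
  eapply dot_eq;
    [|exact (dot_mult _ _ _ _ _ (dot_scale dl _ _ _ hf) (dot_conj _ _ _ hg))].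
  unfold two; autorewrite with Cconj.
  unfold D, Db, p, pb, dl, al, s; fold lb; field; auto.
Qed.

(** Obtained by conjugating [dot_D], which reverses the sign of 4i d/dt. *)
Lemma dot_Db n t : lam <> C0 -> Lax_at h lam U Rf Q f g n t ->
  dot (Db n) t
   (two *c ((lb *c lb -c lam *c lam /c (al *c al)) *c Db n t -c (al -c C1 /c al) *c D n t
         -c Cconj (Rf n t) *c p n t +c Q n t /c al *c pb n t)).
Proof.
  intros hl hL; apply dot_ext with (1 := Cconj_D n).
  eapply dot_eq; [|exact (dot_conj _ _ _ (dot_D n t hl hL))].
  unfold two; autorewrite with Cconj.
  rewrite Cconj_al, Cconj_D, Cconj_Db, Cconj_p, Cconj_pb.
  unfold lb; rewrite Cconj_involutive; ring.
Qed.

Lemma dot_pb n t : lam <> C0 -> Lax_at h lam U Rf Q f g n t ->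
  dot (pb n) t
   (two *c ((lb *c lb +c lb *c lb /c (al *c al)
             -c Rf n t *c Cconj (Rf n t) -c Q n t *c Cconj (Q n t)) *c pb n t
        -c Cconj (Rf n t) *c (two *c al *c Db n t -c s *c D n t)
        +c Cconj (Q n t) /c al *c (s *c Db n t -c two *c al *c D n t))).
Proof.
  intros hl hL; apply dot_ext with (1 := Cconj_p n).
  eapply dot_eq; [|exact (dot_conj _ _ _ (dot_p n t hl hL))].
  unfold two, s, lb; autorewrite with Cconj.
  rewrite Cconj_al, Cconj_D, Cconj_Db, Cconj_p; ring.
Qed.

(** The argument is local: the system and the Lax pair at the single pair (n, t) suffice, because
    the shift equations already determine the data at site n+1. *)
Lemma MTM_at_transform n t :
  0 < h -> lam <> C0 ->
  MTM_at h U Rf Q n t -> Lax_at h lam U Rf Q f g n t ->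
  Udt_den h lam U f g n t <> C0 ->
  Rdt_den lam f g n t <> C0 ->
  Rdt_den lam f g (n + 1)%Z t <> C0 ->
  Qdt_den lam f g n t <> C0 ->
  Qdt_den lam f g (n + 1)%Z t <> C0 ->
  MTM_at h (Udt h lam U f g) (Rdt lam Rf f g) (Qdt lam Q f g) n t.
Proof.
  intros h0 hl (_ & [dR hR] & [dQ hQ] & (dU & hU & E1) & E2 & E3) hL hA hD hD1 hDb hDb1.
  assert (hh : h <> 0) by lra.
  pose proof (kap_neq0 h hh) as hk; fold k in hk.
  assert (hlb : lb <> C0) by (apply Cconj_neq0; exact hl).
  pose proof (Cmult_neq0 _ _ hl hlb : al <> C0) as hal.
  pose proof (one_minus_kap_neq0 h (Cnorm2 (U n t))) as ha.
  pose proof (one_plus_kap_neq0 h (Cnorm2 (U n t))) as hab.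
  rewrite RtoC_Cnorm2 in ha, hab; fold k in ha, hab.
  pose proof (dot_D n t hl hL) as dD; pose proof (dot_Db n t hl hL) as dDb.
  pose proof (dot_p n t hl hL) as dp; pose proof (dot_pb n t hl hL) as dpb.
  assert (E1' := proj1 (MTM_eq1_iff _ _ _ _ _ _ _ hh E2 E3) E1).
  apply C_deriv_at_dot in hU, hR, hQ; rewrite E1' in hU; clear E1 E1'.
  apply MTM_eq2_iff in E2; [|exact hh]; apply MTM_eq3_iff in E3.
  (* The system prescribes no derivative of R or Q, so for these two fields only existence is shown,
     by the quotient rule. *)
  assert (hRd : C_differentiable_at (Rdt lam Rf f g n) t).
  { eapply dot_differentiable, dot_ext; [intro; symmetry; apply Rdt_eq|].
    apply dot_opp_div;
      [exact (dot_plus _ _ _ _ _ (dot_mult _ _ _ _ _ dDb hR) dp)|exact dD|].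
    rewrite <- Rdt_den_eq; exact hD. }
  assert (hQd : C_differentiable_at (Qdt lam Q f g n) t).
  { eapply dot_differentiable, dot_ext;
      [intro; symmetry; apply Qdt_eq_quotient|].
    apply dot_opp_div;
      [exact (dot_plus _ _ _ _ _ (dot_mult _ _ _ _ _ (dot_scale al _ _ _ dD) hQ) dp)
      |exact (dot_scale al _ _ _ dDb)|].
    rewrite <- Qdt_den_eq; exact hDb. }
  rewrite Rdt_den_eq in hD, hD1; rewrite Qdt_den_eq in hDb, hDb1.
  apply Cmult_neq0_inv in hDb as [_ hDb]; apply Cmult_neq0_inv in hDb1 as [_ hDb1].
  assert (hA' := hA); rewrite Udt_den_eq in hA'.
  apply Cmult_neq0_inv in hA' as [h2i hA'].
  assert (eUc : Cconj (darboux_den k al (D n t) (Db n t) (pb n t) (U n t)) =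
    darboux_den (-c k) al (Db n t) (D n t) (p n t) (Cconj (U n t))).
  { unfold darboux_den; autorewrite with Cconj.
    rewrite Cconj_al, Cconj_D, Cconj_Db, Cconj_pb.
    unfold k; rewrite Cconj_kap; reflexivity. }
  assert (eBc : Cconj (darboux_num k al (D n t) (Db n t) (p n t) (U n t)) =
    darboux_num (-c k) al (Db n t) (D n t) (pb n t) (Cconj (U n t))).
  { unfold darboux_num; autorewrite with Cconj.
    rewrite Cconj_al, Cconj_D, Cconj_Db, Cconj_p.
    unfold k; rewrite Cconj_kap; reflexivity. }
  assert (hAb := Cconj_neq0 _ hA'); rewrite eUc in hAb.
  assert (eU : Udt h lam U f g n t =
    -c (darboux_num k al (D n t) (Db n t) (p n t) (U n t)
        /c darboux_den k al (D n t) (Db n t) (pb n t) (U n t))).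
  { rewrite Udt_eq_quotient.
    apply Cmult_neq0_inv in h2i as [h2 hi]; field; auto. }
  assert (eUb : Cconj (Udt h lam U f g n t) =
    -c (darboux_num (-c k) al (Db n t) (D n t) (pb n t) (Cconj (U n t))
        /c darboux_den (-c k) al (Db n t) (D n t) (p n t) (Cconj (U n t)))).
  { rewrite eU, Cconj_opp, Cconj_div, eUc, eBc; reflexivity. }
  assert (eRb : Cconj (Rdt lam Rf f g n t) =
    darboux_R (Db n t) (D n t) (pb n t) (Cconj (Rf n t))).
  { rewrite Rdt_eq; unfold darboux_R; autorewrite with Cconj.
    rewrite Cconj_D, Cconj_Db, Cconj_p; reflexivity. }
  assert (eQb : Cconj (Qdt lam Q f g n t) =
    darboux_Q al (Db n t) (D n t) (pb n t) (Cconj (Q n t))).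
  { rewrite (Qdt_eq _ _ hal hDb); unfold darboux_Q; autorewrite with Cconj.
    rewrite Cconj_al, Cconj_D, Cconj_Db, Cconj_p; reflexivity. }
  destruct (Lax_at_shift _ _ _ _ _ _ _ _ _ hh hl hL) as [ef eg].
  assert (efb := f_equal Cconj ef); assert (egb := f_equal Cconj eg).
  unfold two in efb, egb; autorewrite with Cconj in efb, egb.
  rewrite Cconj_kap in efb, egb; fold two lb k in efb, egb.
  assert (hshift := darboux_shift k al s (D n t) (Db n t) (p n t) (pb n t)
    (U n t) (Cconj (U n t)) (Rf n t) (Rf (n + 1)%Z t) (Q n t) (Q (n + 1)%Z t)
    (D (n + 1)%Z t) (Db (n + 1)%Z t) (p (n + 1)%Z t)).
  cbv zeta in hshift.
  rewrite <- eU, <- eUb, <- !Rdt_eq, <- !(Qdt_eq _ _ hal) in hshift by assumption.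
  destruct (shift_quadratic k lam lb (U n t) (Cconj (U n t)) (f n t) (Cconj (f n t))
    (g n t) (Cconj (g n t)) (f (n + 1)%Z t) (Cconj (f (n + 1)%Z t))
    (g (n + 1)%Z t) (Cconj (g (n + 1)%Z t)) hk hl hlb ha hab ef eg) as (q1 & q2 & q3).
  (* The conjugate of [k *c lam *c a] is [-c k *c lb *c ab]; its sign is moved into the
     numerator. *)
  { rewrite efb; field; auto 7 using Copp_neq0. }
  { rewrite egb; field; auto 7 using Copp_neq0. }
  destruct hshift as [S2 S3]; try assumption.
  { apply p_mul_pb. }
  { fold k in E2; rewrite <- E2; field; exact ha. }
  { fold k in E3; rewrite <- E3; field; exact hab. }
  apply (MTM_eq2_iff h _ _ _ hh) in S2; apply MTM_eq3_iff in S3.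
  assert (hUd : dot (Udt h lam U f g n) t
    (flow k (Udt h lam U f g n t) (Cconj (Udt h lam U f g n t))
      (Rdt lam Rf f g n t) (Cconj (Rdt lam Rf f g n t))
      (Qdt lam Q f g n t) (Cconj (Qdt lam Q f g n t)))).
  { rewrite eUb, eU, eRb, eQb, Rdt_eq, (Qdt_eq _ _ hal hDb).
    (* The five [eq_refl] set the derivatives in [darboux_flow] to the values of the Lax evolution
       and of [flow], turning the goal into the quotient rule. *)
    rewrite <- (darboux_flow k al (lam *c lam) (lb *c lb) (D n t) (Db n t) (p n t) (pb n t)
      (U n t) (Cconj (U n t)) (Rf n t) (Cconj (Rf n t)) (Q n t) (Cconj (Q n t))
      _ _ _ _ _ hk hal hD hDb hA' hAb (p_mul_pb n t)
      eq_refl eq_refl eq_refl eq_refl eq_refl).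
    pose proof (dot_plus _ _ _ _ _
      (dot_mult _ _ _ _ _ (dot_plus _ _ _ _ _ dDb (dot_scale (k *c al) _ _ _ dD)) hU) dp)
      as dnum.
    pose proof (dot_plus _ _ _ _ _ (dot_plus _ _ _ _ _ dD (dot_scale (k *c al) _ _ _ dDb))
      (dot_mult _ _ _ _ _ (dot_scale k _ _ _ dpb) hU)) as dden.
    (* The factor 2i matches [Udt_eq_quotient] and is cancelled only at time t, by
       [Copp_div_scale]. *)
    apply dot_scale with (c := RtoC 2 *c Ci) in dnum.
    apply dot_scale with (c := RtoC 2 *c Ci) in dden.
    eapply dot_eq; [|eapply dot_ext;
      [intro; symmetry; apply Udt_eq_quotient
      |exact (dot_opp_div _ _ _ _ _ dnum dden (Cmult_neq0 _ _ h2i hA'))]].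
    cbv beta; rewrite Copp_div_scale by assumption.
    unfold darboux_den, darboux_num, s in *; fold k; field; auto. }
  refine (conj (dot_differentiable _ _ _ hUd) (conj hRd (conj hQd (conj _ (conj S2 S3))))).
  eexists; split; [exact hUd|].
  apply (MTM_eq1_iff h _ _ _ _ _ _ hh S2 S3).
  fold k; field; exact four_i_neq0.
Qed.
End Transform.

Theorem theorem1 (h : R) (lam : Cpx) (U Rf Q f g : Z -> R -> Cpx) :
  0 < h ->
  lam <> C0 ->
  MTM_solution h U Rf Q ->
  Lax_solution h lam U Rf Q f g ->
  (exists n t, f n t <> C0 \/ g n t <> C0) ->
  forall (n : Z) (t : R),
    Udt_den h lam U f g n t <> C0 ->
    Rdt_den lam f g n t <> C0 ->
    Rdt_den lam f g (n+1)%Z t <> C0 ->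
    Qdt_den lam f g n t <> C0 ->
    Qdt_den lam f g (n+1)%Z t <> C0 ->
    MTM_at h (Udt h lam U f g) (Rdt lam Rf f g) (Qdt lam Q f g) n t.
Proof.
  intros hh hl hM hL _ n t.
  exact (MTM_at_transform h lam U Rf Q f g n t hh hl (hM n t) (hL n t)).
Qed.
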